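(* Let $d=4$. Every non-degenerate system of Monge–Ampère type is ${\bf SL}(6)$-equivalent to one of the following normal forms: 1. $u_2-v_1=0,\ \ u_3+v_4=0$; 2. $u_2-v_1=0,\ \ u_3+v_4+u_1v_2-u_2v_1=0$; 3. $u_2-v_1=0,\ \ u_3v_4-u_4v_3-1=0$; 4. $u_2-v_1=0,\ \ u_1+v_2+u_3v_4-u_4v_3=0$.
   Context: All objects are complex (locally analytic). Let $u(\mathbf x),v(\mathbf x)$ be functions of $\mathbf x=(x^1,\dots,x^d)$, with $u_i=\partial u/\partial x^i$, $v_i=\partial v/\partial x^i$. Let $V=\mathbb{C}^{d+2}$ with coordinates $(x^1,\dots,x^d,u,v)$. A system of Monge–Ampère type is a pair of linearly independent equations $$a^{ij}(u_iv_j-u_jv_i)+b^iu_i+c^iv_i+m=0,\qquad \alpha^{ij}(u_iv_j-u_jv_i)+\beta^iu_i+\gamma^iv_i+\mu=0$$ with constant coefficients. Geometrically the tangent $d$-planes of graphs $u=u(\mathbf x),v=v(\mathbf x)$ are points of ${\bf Gr}(d,V)$ and the system defines a codimension-two submanifold $X\subset{\bf Gr}(d,V)$ (a linear section of its Plücker embedding); solutions are $d$-dimensional submanifolds of $V$ whose tangent spaces lie in $X$. Two systems are ${\bf SL}(d+2)$-equivalent if an element of ${\bf SL}(V)$ (linear change of the coordinates $(x,u,v)$), acting on ${\bf Gr}(d,V)$, maps the $X$ of one to the $X$ of the other. A system $F=G=0$ is non-degenerate if its characteristic variety $\det\big[\sum_{i=1}^d p_i\begin{pmatrix}F_{u_i}&F_{v_i}\\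 G_{u_i}&G_{v_i}\end{pmatrix}\big]=0$ is an irreducible quadric in $p_1,\dots,p_d$ of rank $d$ when $d\le4$ and of rank $4$ when $d>4$. *)

(* Defs.v *)
From HB Require Import structures.
From mathcomp Require Import all_boot all_order all_algebra.
Set Implicit Arguments. Unset Strict Implicit. Unset Printing Implicit Defensive.
Import Order.TTheory GRing.Theory Num.Theory.
Local Open Scope ring_scope.

(* One equation  a^{ij}(u_i v_j - u_j v_i) + b^i u_i + c^i v_i + m = 0
   (indices 1..4 of the paper are 0..3 here; sum over all i, j). *)
Record MAeq (C : Type) := MAEq {
  ma_a : 'I_4 -> 'I_4 -> C; ma_b : 'I_4 -> C; ma_c : 'I_4 -> C; ma_m : C }.

Record MAsys (C : Type) := MASys { sysF : MAeq C; sysG : MAeq C }.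

Section MA.
Variable C : fieldType.

Definition aeval (E : MAeq C) (u v : 'I_4 -> C) : C :=
  \sum_i \sum_j ma_a E i j * (u i * v j - u j * v i)
  + \sum_i ma_b E i * u i + \sum_i ma_c E i * v i + ma_m E.

Definition lin_indep (S : MAsys C) : Prop :=
  forall al be : C,
    (forall u v, al * aeval (sysF S) u v + be * aeval (sysG S) u v = 0) ->
    al = 0 /\ be = 0.

Definition dFu (E : MAeq C) (v : 'I_4 -> C) (k : 'I_4) : C :=
  \sum_j (ma_a E k j - ma_a E j k) * v j + ma_b E k.
Definition dFv (E : MAeq C) (u : 'I_4 -> C) (k : 'I_4) : C :=
  \sum_j (ma_a E j k - ma_a E k j) * u j + ma_c E k.

Definition charM (S : MAsys C) (u v : 'I_4 -> C) (i : 'I_4) : 'M[C]_2 :=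
  \matrix_(r < 2, s < 2)
    if (r : nat) == 0%N then
      (if (s : nat) == 0%N then dFu (sysF S) v i else dFv (sysF S) u i)
    else
      (if (s : nat) == 0%N then dFu (sysG S) v i else dFv (sysG S) u i).

Definition chardet (S : MAsys C) (u v : 'I_4 -> C) (p : 'I_4 -> C) : C :=
  \det (\sum_i p i *: charM S u v i).

Definition basisv (i : 'I_4) : 'I_4 -> C := fun k => ((k == i) : nat)%:R.
Definition polar (q : ('I_4 -> C) -> C) : 'M[C]_4 :=
  \matrix_(i, j)
    ((q (fun k => basisv i k + basisv j k) - q (basisv i) - q (basisv j)) / 2%:R).

Definition quadric_rank (q : ('I_4 -> C) -> C) : nat := \rank (polar q).

Definition onX (S : MAsys C) (u v : 'I_4 -> C) : Prop :=
  aeval (sysF S) u v = 0 /\ aeval (sysG S) u v = 0.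

Inductive polyfun : (('I_4 -> C) -> ('I_4 -> C) -> C) -> Prop :=
| pf_const (c : C) : polyfun (fun _ _ => c)
| pf_u (i : 'I_4) : polyfun (fun u _ => u i)
| pf_v (i : 'I_4) : polyfun (fun _ v => v i)
| pf_add f g : polyfun f -> polyfun g -> polyfun (fun u v => f u v + g u v)
| pf_mul f g : polyfun f -> polyfun g -> polyfun (fun u v => f u v * g u v).

(* good points: the characteristic variety is a quadric of rank 4
   (for d = 4 this forces it to be an irreducible quadric) *)
Definition good_point (S : MAsys C) (u v : 'I_4 -> C) : Prop :=
  onX S u v /\ quadric_rank (chardet S u v) = 4%N.

(* non-degenerate: the characteristic variety is an irreducible quadric of
   rank 4 at a generic point of X, i.e. the good points form a nonempty
   Zariski-dense subset of (the affine part of) X. *)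
Definition MA_nondegenerate (S : MAsys C) : Prop :=
  (exists u v, good_point S u v) /\
  forall h, polyfun h ->
    (forall u v, good_point S u v -> h u v = 0) ->
    forall u v, onX S u v -> h u v = 0.

(* coordinates of V = C^6: columns 0..3 = x^1..x^4, column 4 = u, column 5 = v *)
Definition xcol (k : 'I_4) : 'I_6 := @widen_ord 4 6 isT k.
Definition ucol : 'I_6 := @Ordinal 6 4 isT.
Definition vcol : 'I_6 := @Ordinal 6 5 isT.
Definition colsel1 (i : 'I_4) (t : 'I_6) : 'I_4 -> 'I_6 :=
  fun k => if k == i then t else xcol k.
Definition colsel2 (i j : 'I_4) : 'I_4 -> 'I_6 :=
  fun k => if k == i then ucol else if k == j then vcol else xcol k.

(* A 4-plane W in V is given by a rank-4 matrix P : 'M_(4,6) whose rows span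
   W.  heval E P is the linear form on the Pluecker coordinates (4x4 minors
   of P) homogenising E: on the graph plane with rows e_i + u_i e_u + v_i e_v
   it equals aeval E u v, and it scales by det A under P |-> A *m P, so its
   vanishing only depends on W. *)
Definition heval (E : MAeq C) (P : 'M[C]_(4, 6)) : C :=
  \sum_i \sum_(j | i != j) ma_a E i j * \det (mxsub id (colsel2 i j) P)
  + \sum_i ma_b E i * \det (mxsub id (colsel1 i ucol) P)
  + \sum_i ma_c E i * \det (mxsub id (colsel1 i vcol) P)
  + ma_m E * \det (mxsub id xcol P).

(* W in X  (X = codimension-two linear section of Gr(4,V)) *)
Definition inX (S : MAsys C) (P : 'M[C]_(4, 6)) : Prop :=
  heval (sysF S) P = 0 /\ heval (sysG S) P = 0.

Definition SL_equiv (S1 S2 : MAsys C) : Prop :=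
  exists g : 'M[C]_6, \det g = 1 /\
    forall P : 'M[C]_(4, 6), \rank P = 4%N ->
      (inX S1 P <-> inX S2 (P *m g)).

Definition dlt (i : 'I_4) (n : nat) : C := ((i : nat) == n)%:R.
Definition z2 : 'I_4 -> 'I_4 -> C := fun _ _ => 0.
Definition z1 : 'I_4 -> C := fun _ => 0.

Definition eqA : MAeq C := MAEq z2 (fun i => dlt i 1) (fun i => - dlt i 0) 0.
Definition NF1 : MAsys C :=
  MASys eqA (MAEq z2 (fun i => dlt i 2) (fun i => dlt i 3) 0).
Definition NF2 : MAsys C :=
  MASys eqA (MAEq (fun i j => dlt i 0 * dlt j 1)
                  (fun i => dlt i 2) (fun i => dlt i 3) 0).
Definition NF3 : MAsys C :=
  MASys eqA (MAEq (fun i j => dlt i 2 * dlt j 3) z1 z1 (-1)).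
Definition NF4 : MAsys C :=
  MASys eqA (MAEq (fun i j => dlt i 2 * dlt j 3)
                  (fun i => dlt i 0) (fun i => dlt i 1) 0).

End MA.

(* Main.v *)
(** A Monge-Ampere equation is a bivector on V, i.e. a skew 6x6 matrix N: a
    4-plane W satisfies it iff N vanishes on the 2-dimensional annihilator
    of W. A system is therefore a pencil of skew matrices, considered up to
    congruence and change of basis of the pencil.

    At a point of X where the characteristic quadric has rank 4, with
    annihilator spanned by t1 and t2, both matrices F and G vanish on
    (t1, t2), and F t1, F t2, G t1, G t2 are linearly independent. Taking them
    as new coordinates leaves only the freedom of adding multiples of t1, t2
    to the other covectors, which reduces the pencil l F + m G to
      [ (p l + p2 m) eps   0                   l I ]
      [ 0                  (q l + q2 m) eps    m I ]
      [ - l I              - m I               0   ]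
    with eps = [[0, 1], [-1, 0]] and Pfaffian, up to sign, the binary cubic
      q l^3 + q2 l^2 m + p l m^2 + p2 m^3.
    Changing the basis of the pencil acts on this cubic by linear
    substitution, up to a factor, so there are four classes: zero (NF1), a
    triple root (NF2), a double root (NF3) and three simple roots (NF4). *)

Require Import Defs.
From HB Require Import structures.
From mathcomp Require Import all_boot all_order all_algebra all_fingroup.
From mathcomp Require Import ring.
Import GRing.Theory Num.Theory.
Local Open Scope ring_scope.
Set Implicit Arguments. Unset Strict Implicit. Unset Printing Implicit Defensive.

(** * Complementary minors *)

Section Compl.

Variable C : fieldType.
Implicit Types (P : 'M[C]_(4, 6)) (r s : 'rV[C]_6) (g N : 'M[C]_6).

Definition augdet P r s : C := \det (col_mx P (col_mx r s) : 'M_(4 + (1 + 1))).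

(** For distinct k and l the entry is, up to sign, the minor of [P] on the four columns other than k
    and l. The Plücker coordinates become a skew matrix with the signs of the column choices built
    in. *)
Definition cominors P : 'M[C]_6 :=
  \matrix_(k, l) augdet P (delta_mx 0 k) (delta_mx 0 l).

Lemma augdet_anti P r s : augdet P r s = - augdet P s r.
Proof.
rewrite /augdet.
have -> : col_mx P (col_mx r s) =
   xrow (rshift 4 (lshift 1 0)) (rshift 4 (rshift 1 0)) (col_mx P (col_mx s r)).
  rewrite /xrow row_permEsub; apply/row_matrixP => i; rewrite row_rowsub.
  case: (split_ordP i) => k ->; last case: (split_ordP k) => l ->.
  - by rewrite tpermD ?eq_rlshift // !rowKu.
  - by rewrite ord1 tpermL !rowKd !rowKu.
  - by rewrite ord1 tpermR !rowKd !rowKu.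
rewrite xrowE det_mulmx det_perm odd_tperm.
by rewrite -(inj_eq val_inj) /= expr1 mulN1r.
Qed.

Lemma augdet_sumr P (I : finType) (c : I -> C) (w : I -> 'rV[C]_6) r :
  augdet P r (\sum_i c i *: w i) = \sum_i c i * augdet P r (w i).
Proof.
(* The cofactors along the last row do not involve that row, so they may be taken with 0 in its
   place; linearity in [s] is then visible. *)
have key s : augdet P r s = \sum_j s 0 j *
  cofactor (col_mx P (col_mx r 0) : 'M_(4 + (1 + 1))) (rshift 4 (rshift 1 0)) j.
  rewrite /augdet (expand_det_row _ (rshift 4 (rshift 1 0))).
  apply: eq_bigr => j _; rewrite !col_mxEd; congr (_ * _).
  rewrite /cofactor; congr (_ * \det _); apply/matrixP=> a b; rewrite !mxE.
  case: splitP => // k ek; rewrite !mxE; case: splitP => // l el.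
  have /eqP[] := neq_lift (rshift 4 (rshift 1 0) : 'I_(4 + (1 + 1))) a.
  by apply: val_inj; apply: esym; rewrite [LHS]ek el ord1.
rewrite key; under [RHS]eq_bigr do rewrite key mulr_sumr.
rewrite exchange_big /=; apply: eq_bigr => j _.
by rewrite summxE mulr_suml; apply: eq_bigr => i _; rewrite mxE mulrA.
Qed.

Lemma augdetE P r s : augdet P r s = (r *m cominors P *m s^T) 0 0.
Proof.
rewrite {1}[s]row_sum_delta augdet_sumr mxE; apply: eq_bigr => j _.
rewrite [RHS]mulrC; congr (_ * _); first by rewrite mxE.
rewrite augdet_anti {1}[r]row_sum_delta augdet_sumr mxE -sumrN.
by apply: eq_bigr => i _; rewrite mxE -mulrN -augdet_anti.
Qed.

Lemma cominors_anti P : (cominors P)^T = - cominors P.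
Proof. by apply/matrixP => i j; rewrite !mxE augdet_anti. Qed.

(** Rows [i] and [j] of [g] are the images of the unit rows, so augmenting [P *m g] by them amounts
    to augmenting [P] by unit rows and then multiplying by [g]. *)
Lemma cominors_mul P g : g *m cominors (P *m g) *m g^T = \det g *: cominors P.
Proof.
apply/matrixP => i j; rewrite [RHS]mxE [cominors P i j]mxE.
transitivity (augdet (P *m g) (row i g) (row j g)).
  rewrite augdetE -row_mul tr_row [LHS]mxE [RHS]mxE.
  by apply: eq_bigr => k _; rewrite [row _ _ _ _]mxE [col _ _ _ _]mxE.
rewrite /augdet !rowE -!mul_col_mx det_mulmx mulrC //.
Qed.

(** Permuting the columns of the augmented matrix by [s] carries the two unit rows to the last two
    columns. The result is block triangular with an identity corner, and the other diagonal block is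
    the desired minor. *)
Lemma cominors_perm P (s : 'S_6) :
  \det (mxsub id (fun k => s (Defs.xcol k)) P) =
  (-1) ^+ s * cominors P (s ucol) (s vcol).
Proof.
rewrite [cominors P _ _]mxE /augdet.
set B := col_mx P _.
pose X : 'M_(4 + 2, 4 + 2) := col_perm s B.
have eul : ulsubmx X = mxsub id (fun k => s (Defs.xcol k)) P.
  apply/matrixP => i j; transitivity (B (lshift _ i) (s (lshift 2 j))); first by rewrite 3!mxE.
  rewrite /B col_mxEu [RHS]mxE; congr (P _ (s _)); exact: val_inj.
have edown (i : 'I_2) j : X (rshift 4 i) j = (j == rshift 4 i)%:R.
  transitivity (B (rshift 4 (i : 'I_(1 + 1))) (s j)); first by rewrite mxE.
  rewrite /B col_mxEd; case: (@split_ordP 1 1 i) => k ->;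
    rewrite ?col_mxEu ?col_mxEd mxE (inj_eq perm_inj) ord1 eqxx /=;
    by congr (_ == _)%:R; apply: val_inj.
have edl : dlsubmx X = 0.
  apply/matrixP => i j; transitivity (X (rshift 4 i) (lshift 2 j)); first by rewrite 2!mxE.
  by rewrite edown eq_lrshift mxE.
have edr : drsubmx X = 1%:M.
  apply/matrixP => i j; transitivity (X (rshift 4 i) (rshift 4 j)); first by rewrite 2!mxE.
  by rewrite edown eq_rshift mxE eq_sym.
have : \det X = (-1) ^+ s * \det B.
  by rewrite /X col_permE det_mulmx det_perm odd_permV mulrC.
by rewrite -(submxK X) eul edl edr det_ublock det1 mulr1.
Qed.

Definition pairing N P : C := \tr (N *m cominors P).

(** Cyclicity of the trace moves the outer factors onto the cominors, where [cominors_mul] applies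
    to [g^T]. *)
Lemma pairing_congr g N P :
  pairing (g *m N *m g^T) (P *m g^T) = \det g * pairing N P.
Proof.
have := cominors_mul P g^T; rewrite trmxK det_tr => e.
rewrite /pairing -!mulmxA mxtrace_mulC -!mulmxA [g^T *m (_ *m g)]mulmxA e.
by rewrite -scalemxAr linearZ.
Qed.

End Compl.

(** * Equations as bivectors *)

Section Bivector.

Variable C : numClosedFieldType.
Implicit Types (E : MAeq C) (P : 'M[C]_(4, 6)) (g N M : 'M[C]_6).

Definition quadpart E : 'M[C]_4 := \matrix_(i, j) (ma_a E i j - ma_a E j i).
Lemma tr_quadpart E : (quadpart E)^T = - quadpart E.
Proof. by apply/matrixP => i j; rewrite !mxE opprB. Qed.

(** Replacing column x^i by u leaves out x^i and v, so b belongs to the pair (x^i, v) and, likewise,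
    c to (x^i, u). The sign of b is that of the transposition involved. *)
Definition linpart E : 'M[C]_(4, 2) :=
  \matrix_(i, s) if s == 0 then ma_c E i else - ma_b E i.
Definition epsmx : 'M[C]_2 := \matrix_(i, j) ((j : nat)%:R - (i : nat)%:R).
Definition bivector E : 'M[C]_6 :=
  block_mx (quadpart E) (linpart E) (- (linpart E)^T) (ma_m E *: epsmx)
    : 'M_(4 + 2).

Lemma xcol_neq_ucol k : Defs.xcol k != ucol.
Proof. by case: k => -[|[|[|[|k]]]]. Qed.

Lemma xcol_neq_vcol k : Defs.xcol k != vcol.
Proof. by case: k => -[|[|[|[|k]]]]. Qed.

Lemma cominors_colsel2 P i j : i != j ->
  \det (mxsub id (colsel2 i j) P) = cominors P (Defs.xcol i) (Defs.xcol j).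
Proof.
have [xu xv] := (xcol_neq_ucol, xcol_neq_vcol).
(* The two transpositions are disjoint, so [s] is even and no sign appears. *)
move=> ij; pose s := (tperm (Defs.xcol i) ucol * tperm (Defs.xcol j) vcol)%g.
have xx k l : (Defs.xcol k == Defs.xcol l) = (k == l) by [].
have := cominors_perm P s.
rewrite odd_permM !odd_tperm xu xv /= mul1r => e.
transitivity (\det (colsub (fun k => s (Defs.xcol k)) P)).
  congr (\det _); apply/matrixP => r k; rewrite !mxE; congr (P _ _).
  rewrite /colsel2 permM; have [->|ki] := eqVneq k i.
    by rewrite tpermL tpermD // eq_sym // xv.
  rewrite (@tpermD _ (Defs.xcol i)) ?xx 1?eq_sym //.
  have [->|kj] := eqVneq k j; first by rewrite tpermL.
  by rewrite tpermD ?xx // eq_sym // xv.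
rewrite e !permM tpermR; congr (cominors _ _ _).
  by rewrite tpermD // ?xx 1?eq_sym // ?xv.
by rewrite (@tpermD _ _ _ vcol) // tpermR.
Qed.

Lemma cominors_colsel1u P i :
  \det (mxsub id (colsel1 i ucol) P) = - cominors P (Defs.xcol i) vcol.
Proof.
have [xu xv] := (xcol_neq_ucol, xcol_neq_vcol).
have := cominors_perm P (tperm (Defs.xcol i) ucol).
rewrite odd_tperm xu tpermR tpermD // expr1 mulN1r => <-.
congr (\det _); apply/matrixP => r k; rewrite !mxE; congr (P _ _).
rewrite /colsel1; have [->|ki] := eqVneq k i; first by rewrite tpermL.
by rewrite tpermD // 1?eq_sym.
Qed.

Lemma cominors_colsel1v P i :
  \det (mxsub id (colsel1 i vcol) P) = - cominors P ucol (Defs.xcol i).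
Proof.
have [xu xv] := (xcol_neq_ucol, xcol_neq_vcol).
have := cominors_perm P (tperm (Defs.xcol i) vcol).
rewrite odd_tperm xv tpermR tpermD // expr1 mulN1r => <-.
congr (\det _); apply/matrixP => r k; rewrite !mxE; congr (P _ _).
rewrite /colsel1; have [->|ki] := eqVneq k i; first by rewrite tpermL.
by rewrite tpermD // 1?eq_sym.
Qed.

Lemma cominors_xcol P : \det (mxsub id Defs.xcol P) = cominors P ucol vcol.
Proof.
have := cominors_perm P 1%g; rewrite odd_perm1 !perm1 mul1r => <-.
by congr (\det _); apply/matrixP => r k; rewrite !mxE perm1.
Qed.

(** The trace meets every pair of coordinates twice, and by skewness of both factors the two terms
    agree, each being minus the product of corresponding entries. Hence the factor -2. *)
Lemma pairing_bivector E P : pairing (bivector E) P = - 2%:R * heval E P.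
Proof.
have K_anti k l : cominors P k l = - cominors P l k.
  by have /matrixP/(_ l k) := cominors_anti P; rewrite [LHS]mxE [RHS]mxE.
have Kd k : cominors P k k = 0.
  by apply/eqP; have /eqP := addNr (cominors P k k); rewrite -K_anti -mulr2n mulrn_eq0.
have lx (k : 'I_4) : lshift 2 k = Defs.xcol k by apply: val_inj.
have ru : rshift 4 (ord0 : 'I_2) = ucol by apply: val_inj.
have rv : rshift 4 (lift ord0 ord0 : 'I_2) = vcol by apply: val_inj.

pose T := \sum_i \sum_j ma_a E i j * cominors P (Defs.xcol i) (Defs.xcol j).
have -> : heval E P = T - \sum_i ma_b E i * cominors P (Defs.xcol i) vcol
    + \sum_i ma_c E i * cominors P (Defs.xcol i) ucol + ma_m E * cominors P ucol vcol.
  rewrite /heval cominors_xcol -sumrN; congr (_ + _ + _ + _).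
  - apply: eq_bigr => i _; rewrite [RHS](bigID (fun j => i != j)) /=.
    rewrite [X in _ = _ + X]big1 ?addr0.
      by apply: eq_bigr => j ij; rewrite cominors_colsel2.
    by move=> j; rewrite negbK => /eqP <-; rewrite Kd mulr0.
  - by apply: eq_bigr => i _; rewrite cominors_colsel1u mulrN.
  - by apply: eq_bigr => i _; rewrite cominors_colsel1v K_anti opprK.
have -> : pairing (bivector E) P =
    \sum_i \sum_j quadpart E i j * cominors P (Defs.xcol j) (Defs.xcol i)
    + \sum_i \sum_s linpart E i s * cominors P (rshift 4 s) (Defs.xcol i)
    + (\sum_s \sum_j - linpart E j s * cominors P (Defs.xcol j) (rshift 4 s)
    + \sum_s \sum_t ma_m E * epsmx s t * cominors P (rshift 4 t) (rshift 4 s)).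
  rewrite /pairing /mxtrace (@big_split_ord _ _ _ 4 2) /= -!big_split /=.
  congr (_ + _); apply: eq_bigr => i _; rewrite mxE (@big_split_ord _ _ _ 4 2) /=;
    congr (_ + _); apply: eq_bigr => j _; rewrite -?lx.
  - by congr (_ * _); exact: (@block_mxEul _ 4 2 4 2).
  - by congr (_ * _); exact: (@block_mxEur _ 4 2 4 2).
  - by congr (_ * _); apply: etrans (@block_mxEdl _ 4 2 4 2 _ _ _ _ _ _) _; rewrite !mxE.
  - by congr (_ * _); apply: etrans (@block_mxEdr _ 4 2 4 2 _ _ _ _ _ _) _; rewrite mxE.
have -> : \sum_i \sum_j quadpart E i j * cominors P (Defs.xcol j) (Defs.xcol i) = - 2%:R * T.
  under eq_bigr do under eq_bigr do rewrite mxE mulrBl.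
  under eq_bigr do rewrite sumrB.
  rewrite sumrB [X in _ - X]exchange_big /= -/T.
  have -> : \sum_i \sum_j ma_a E i j * cominors P (Defs.xcol j) (Defs.xcol i) = - T.
    rewrite /T -sumrN; apply: eq_bigr => i _; rewrite -sumrN; apply: eq_bigr => j _.
    by rewrite K_anti mulrN.
  by ring.
rewrite [X in _ + (X + _)]exchange_big /= addrA -[X in X + _ = _]addrA -big_split /=.
have -> : \sum_s \sum_t ma_m E * epsmx s t * cominors P (rshift 4 t) (rshift 4 s) =
    - 2%:R * (ma_m E * cominors P ucol vcol).
  rewrite !big_ord_recl !big_ord0 ru rv !Kd [cominors P vcol ucol]K_anti.
  have -> : epsmx ord0 (lift ord0 ord0) = 1 by rewrite mxE subr0.
  have -> : epsmx (lift ord0 ord0) ord0 = -1 by rewrite mxE sub0r.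
  by ring.
rewrite [in RHS]mulrDr -[T - _ + _]addrA [in RHS]mulrDr -sumrN -big_split /=.
congr (_ + _ + _); rewrite mulr_sumr; apply: eq_bigr => i _.
rewrite !big_ord_recl !big_ord0 ru rv [cominors P vcol _]K_anti [cominors P ucol _]K_anti.
have -> : linpart E i ord0 = ma_c E i by rewrite mxE.
have -> : linpart E i (lift ord0 ord0) = - ma_b E i by rewrite mxE.
by ring.
Qed.

(** * Equivalence of pencils *)

Definition pencil_vanish (N M : 'M[C]_6) P := pairing N P = 0 /\ pairing M P = 0.

(** Only common zero sets are compared, so changing the basis of the pencil costs nothing. The
    matrix [g] is merely invertible; determinant 1 is restored in [pencil_equiv_SL]. *)
Definition pencil_equiv N M N' M' :=
  exists2 g, g \in unitmx &
    forall P, pencil_vanish N M P <-> pencil_vanish N' M' (P *m g).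

Lemma pencil_equiv_trans N2 M2 N1 M1 N3 M3 :
  pencil_equiv N1 M1 N2 M2 -> pencil_equiv N2 M2 N3 M3 -> pencil_equiv N1 M1 N3 M3.
Proof.
move=> [g gu Hg] [h hu Hh]; exists (g *m h); first by rewrite unitmx_mul gu.
by move=> P; rewrite mulmxA; apply: iff_trans (Hg P) (Hh _).
Qed.

Lemma pencil_equiv_sym N1 M1 N2 M2 : pencil_equiv N1 M1 N2 M2 -> pencil_equiv N2 M2 N1 M1.
Proof.
move=> [g gu Hg]; exists (invmx g); first by rewrite unitmx_inv.
by move=> P; have := Hg (P *m invmx g); rewrite mulmxKV //; exact: iff_sym.
Qed.

Lemma pencil_equiv_congr g N M : g \in unitmx ->
  pencil_equiv N M (g *m N *m g^T) (g *m M *m g^T).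
Proof.
move=> gu; have := gu; rewrite unitmxE unitfE => /negPf dg.
exists g^T => [|P]; first by rewrite unitmx_tr.
rewrite /pencil_vanish !pairing_congr.
split=> -[/eqP e1 /eqP e2]; move: e1 e2; rewrite ?mulf_eq0 ?dg /=.
  by move=> /eqP -> /eqP ->; rewrite !mulr0.
by move=> /eqP -> /eqP ->.
Qed.

Lemma pairingD N M P : pairing (N + M) P = pairing N P + pairing M P.
Proof. by rewrite /pairing mulmxDl linearD. Qed.
Lemma pairingZ c N P : pairing (c *: N) P = c * pairing N P.
Proof. by rewrite /pairing -scalemxAl linearZ. Qed.

Lemma pencil_equiv_base N M N' M' :
  (forall P, pencil_vanish N M P <-> pencil_vanish N' M' P) ->
  pencil_equiv N M N' M'.
Proof. by move=> H; exists 1%:M; rewrite ?unitmx1 // => P; rewrite mulmx1. Qed.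

Lemma pencil_equiv_swap N M : pencil_equiv N M M N.
Proof. by apply: pencil_equiv_base => P; rewrite /pencil_vanish; split => -[]. Qed.

Lemma pencil_equiv_shear t N M : pencil_equiv N M N (M + t *: N).
Proof.
apply: pencil_equiv_base => P; rewrite /pencil_vanish pairingD pairingZ.
by split=> -[-> ]; rewrite mulr0 addr0.
Qed.

Lemma pencil_equiv_scale s t N M : s != 0 -> t != 0 -> pencil_equiv N M (s *: N) (t *: M).
Proof.
move=> s0 t0; apply: pencil_equiv_base => P; rewrite /pencil_vanish !pairingZ.
split=> -[e1 e2]; first by rewrite e1 e2 !mulr0.
by split; [apply: (mulfI s0)|apply: (mulfI t0)]; rewrite mulr0.
Qed.

Lemma inXE (S : MAsys C) P :
  inX S P <-> pencil_vanish (bivector (sysF S)) (bivector (sysG S)) P.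
Proof.
rewrite /inX /pencil_vanish !pairing_bivector.
split=> -[e1 e2]; first by rewrite e1 e2 !mulr0.
by split; apply: (@mulfI _ (- 2%:R)); rewrite ?mulr0 // oppr_eq0 pnatr_eq0.
Qed.

Lemma pairing_scale N P c : pairing N (c *: P) = c ^+ 4 * pairing N P.
Proof.
rewrite /pairing (_ : cominors (c *: P) = c ^+ 4 *: cominors P) -?scalemxAr ?linearZ //.
apply/matrixP => i j; rewrite !mxE /augdet.
have -> : col_mx (c *: P) (col_mx (delta_mx 0 i) (delta_mx 0 j)) =
  (block_mx (c%:M : 'M_4) 0 0 1%:M : 'M_(4 + (1 + 1))) *m
    col_mx P (col_mx (delta_mx 0 i) (delta_mx 0 j)).
  by rewrite mul_block_col !mul0mx addr0 add0r mul1mx mul_scalar_mx.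
by rewrite det_mulmx det_ublock det_scalar det1 mulr1.
Qed.

(** Multiplying [g] by a sixth root of the inverse of its determinant gives determinant 1, and only
    multiplies the pairings by a nonzero fourth power. *)
Lemma pencil_equiv_SL (S1 S2 : MAsys C) :
  pencil_equiv (bivector (sysF S1)) (bivector (sysG S1))
         (bivector (sysF S2)) (bivector (sysG S2)) ->
  SL_equiv S1 S2.
Proof.
move=> [g gu Hg].
pose c := 6.-root (\det g)^-1.
have c6 : c ^+ 6 = (\det g)^-1 by rewrite rootCK.
move: gu; rewrite unitmxE unitfE => dg.
have c0 : c != 0.
  by apply/eqP => c0; move/eqP: c6; rewrite c0 expr0n /= eq_sym invr_eq0 (negPf dg).
exists (c *: g); split; first by rewrite detZ c6 mulVf.
move=> P _; rewrite !inXE Hg /pencil_vanish -scalemxAr !pairing_scale.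
have cI := mulfI (expf_neq0 4 c0).
split=> -[e1 e2]; first by rewrite e1 e2 !mulr0.
by split; apply: cI; rewrite mulr0.
Qed.

End Bivector.

(** * Canonical pencils and binary cubics *)

Section Canon.

Variable C : numClosedFieldType.
Implicit Types (E : MAeq C) (P : 'M[C]_(4, 6)) (g N M : 'M[C]_6).
Notation eps := (epsmx C).

(** The zero corner records that the form vanishes on the annihilator (t1, t2) of a point of X; the
    columns of [J] are the images of t1 and t2. *)
Definition skewmx (A : 'M[C]_4) (J : 'M[C]_(4, 2)) : 'M[C]_6 :=
  block_mx A J (- J^T) 0 : 'M_(4 + 2).

(** Congruence by the block triangular matrix [[L, S], [0, d]] keeps the zero corner: [d] changes
    the basis of t1, t2, [L] that of the other covectors, and [S] adds multiples of t1, t2 to the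
    latter. *)
Lemma pencil_equiv_skewmx L S d A J B K A' J' B' K' :
  L \in unitmx -> d \in unitmx ->
  L *m A *m L^T + (L *m J *m S^T - S *m J^T *m L^T) = A' -> L *m J *m d^T = J' ->
  L *m B *m L^T + (L *m K *m S^T - S *m K^T *m L^T) = B' -> L *m K *m d^T = K' ->
  pencil_equiv (skewmx A J) (skewmx B K) (skewmx A' J') (skewmx B' K').
Proof.
move=> Lu du <- <- <- <-; pose g : 'M_6 := block_mx L S 0 d : 'M_(4 + 2).
have gu : g \in unitmx.
  rewrite unitmxE /g (det_ublock L S d) unitrM -!unitmxE; exact/andP.
have gE X Y : g *m skewmx X Y *m g^T =
    skewmx (L *m X *m L^T + (L *m Y *m S^T - S *m Y^T *m L^T)) (L *m Y *m d^T).
  rewrite /g /skewmx (tr_block_mx L S 0 d).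
  rewrite (mulmx_block L S 0 d X Y (- Y^T) 0).
  rewrite (@mulmx_block _ 4 2 4 2 4 2 _ _ _ _ L^T 0^T S^T d^T).
  rewrite !mul0mx !mulmx0 !add0r !addr0 trmx0 !mulmx0 !add0r !trmx_mul trmxK.
  rewrite !mulmxDl !mulmxN !mulNmx -!mulmxA.
  by rewrite !mul0mx !addr0 -[_ - _ + _]addrA [- _ + _]addrC.
by have := pencil_equiv_congr (skewmx A J) (skewmx B K) gu; rewrite !gE.
Qed.

Definition J1 : 'M[C]_(4, 2) := col_mx 1%:M 0 : 'M_(2 + 2, 2).
Definition J2 : 'M[C]_(4, 2) := col_mx 0 1%:M : 'M_(2 + 2, 2).
Definition deps (p q : C) : 'M[C]_4 :=
  block_mx (p *: eps) 0 0 (q *: eps) : 'M_(2 + 2).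

Lemma eq_block22 (a a' b b' c c' d d' : 'M[C]_2) :
  a = a' -> b = b' -> c = c' -> d = d' ->
  block_mx a b c d = block_mx a' b' c' d' :> 'M_4.
Proof. by move=> -> -> -> ->. Qed.

Lemma tr_eps : eps^T = - eps.
Proof. by apply/matrixP => i j; rewrite !mxE opprB. Qed.

Lemma skew2 (X : 'M[C]_2) : X^T = - X -> X = X 0 1 *: eps.
Proof.
move=> /matrixP e.
have d i : X i i = 0.
  apply/eqP; have /eqP := addNr (X i i); move: (e i i); rewrite !mxE => {1}<-.
  by rewrite -mulr2n mulrn_eq0.
have := e 1 0; rewrite !mxE => e10.
apply/matrixP => i j; rewrite !mxE.
case: i => -[|[|//]] ip; case: j => -[|[|//]] jp /=;
  rewrite ?subrr ?mulr0 ?subr0 ?sub0r ?mulr1 ?mulrN1.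
- by rewrite (_ : Ordinal ip = Ordinal jp) ?d //; apply: val_inj.
- by congr (X _ _); apply: val_inj.
- by rewrite e10 opprK; congr (X _ _); apply: val_inj.
- by rewrite (_ : Ordinal ip = Ordinal jp) ?d //; apply: val_inj.
Qed.

(* [f = (p, q, p2, q2)] encodes the cubic
   [q l^3 + q2 l^2 m + p l m^2 + p2 m^3]. *)
Definition reaches_canon N M (f : C * C * C * C) :=
  let: (p, q, p2, q2) := f in
  pencil_equiv N M (skewmx (deps p q) J1) (skewmx (deps p2 q2) J2).

Definition cubic_equiv (f f' : C * C * C * C) :=
  let: (p, q, p2, q2) := f in
  reaches_canon (skewmx (deps p q) J1) (skewmx (deps p2 q2) J2) f'.

(** The eight entries of a shear suffice to clear one 2x2 off-diagonal block in each form. The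
    diagonal blocks stay skew, hence multiples of [eps]. *)
Lemma canonicalize (A B : 'M[C]_4) : A^T = - A -> B^T = - B ->
  exists f, reaches_canon (skewmx A J1) (skewmx B J2) f.
Proof.
move=> Ask Bsk.
have sub (X : 'M[C]_(2 + 2)) : X^T = - X -> exists p q Y,
    X = block_mx (p *: eps) Y (- Y^T) (q *: eps).
  move=> Xs; exists (ulsubmx X 0 1), (drsubmx X 0 1), (ursubmx X).
  have e i j : X j i = - X i j by move/matrixP: Xs => /(_ i j); rewrite !mxE.
  rewrite -skew2; last by apply/matrixP => i j; rewrite !mxE e.
  rewrite -skew2; last by apply/matrixP => i j; rewrite !mxE e.
  rewrite -[LHS]submxK; congr block_mx.
  by apply/matrixP => i j; rewrite !mxE e.
(* The covector shear S kills the off-diagonal block Z of B by its upper half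
   and the off-diagonal block Y of A by its lower half. *)
have [p [q [Y eA]]] := sub A Ask; have [p2 [q2 [Z eB]]] := sub B Bsk.
pose S : 'M[C]_(4, 2) := col_mx Z (- Y^T) : 'M_(2 + 2, 2).
have Zs : (Z^T - Z)^T = - (Z^T - Z) by rewrite linearB /= trmxK opprB.
have Ys : (Y^T - Y)^T = - (Y^T - Y) by rewrite linearB /= trmxK opprB.
(* Besides clearing [Y] and [Z], the shear adds [Z^T - Z] to the upper diagonal block of [A] and
   [Y^T - Y] to the lower one of [B]. *)
exists (p + (Z^T - Z) 0 1, q, p2, q2 + (Y^T - Y) 0 1).
apply: (@pencil_equiv_skewmx 1%:M S 1%:M); rewrite ?unitmx1 // trmx1 !mul1mx !mulmx1 //.
- rewrite /J1 /S !(@tr_col_mx _ 2 2 2) linearN /= trmxK.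
  rewrite !(@mul_col_row _ 2 2 2 2 2) !trmx0 trmx1 !mul1mx !mulmx1 !mul0mx !mulmx0.
  rewrite eA (@opp_block_mx _ 2 2 2 2) !(@add_block_mx _ 2 2 2 2) /deps scalerDl -skew2 //.
  by rewrite !subr0 !sub0r opprK addrN addNr addr0.
- rewrite /J2 /S !(@tr_col_mx _ 2 2 2) linearN /= trmxK.
  rewrite !(@mul_col_row _ 2 2 2 2 2) !trmx0 trmx1 !mul1mx !mulmx1 !mul0mx !mulmx0.
  rewrite eB (@opp_block_mx _ 2 2 2 2) !(@add_block_mx _ 2 2 2 2) /deps scalerDl -skew2 //.
  by rewrite !subr0 sub0r opprK addrN addNr addr0 [- Y + _]addrC.
Qed.

(** * Linear substitutions in the binary cubic *)

Lemma cubic_swap p q p2 q2 :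
  cubic_equiv (p, q, p2, q2) (q2, p2, q, p).
Proof.
apply: pencil_equiv_trans (pencil_equiv_swap _ _) _.
(* Swapping the two generators also swaps [J1] and [J2]; exchanging the two halves of the covectors
   undoes the latter. On the cubic, l and m are exchanged. *)
pose L : 'M[C]_4 := block_mx 0 1%:M 1%:M 0 : 'M_(2 + 2).
have LT : L^T = L by rewrite /L (@tr_block_mx _ 2 2 2 2) !trmx0 !trmx1.
have LL : L *m L = 1%:M.
  rewrite /L (@mulmx_block _ 2 2 2 2 2 2) !mulmx0 !mul0mx !mulmx1 ?addr0 ?add0r.
  by rewrite -(@scalar_mx_block _ 2 2).
have LD x y : L *m deps x y *m L^T = deps y x.
  rewrite LT /L /deps !(@mulmx_block _ 2 2 2 2 2 2).
  by rewrite !mulmx0 !mul0mx !mulmx1 !mul1mx ?addr0 ?add0r.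
have LJ1 : L *m J1 = J2.
  by rewrite /L /J1 (@mul_block_col _ 2 2 2 2 2) !mulmx0 !mul0mx !mulmx1 ?addr0 ?add0r.
have LJ2 : L *m J2 = J1.
  by rewrite /L /J2 (@mul_block_col _ 2 2 2 2 2) !mulmx0 !mul0mx !mulmx1 ?addr0 ?add0r.
apply: (@pencil_equiv_skewmx L 0 1%:M); rewrite ?unitmx1 //.
- by case: (mulmx1_unit LL).
- by rewrite LD trmx0 mulmx0 !mul0mx subr0 addr0.
- by rewrite LJ2 trmx1 mulmx1.
- by rewrite LD trmx0 mulmx0 !mul0mx subr0 addr0.
- by rewrite LJ1 trmx1 mulmx1.
Qed.

Lemma skewmxZ s A J : s *: skewmx A J = skewmx (s *: A) (s *: J).
Proof.
by rewrite /skewmx (@scale_block_mx _ 4 2 4 2) scalerN scaler0 [(s *: J)^T]linearZ.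
Qed.
Lemma skewmxD A J B K : skewmx A J + skewmx B K = skewmx (A + B) (J + K).
Proof.
by rewrite /skewmx (@add_block_mx _ 4 2 4 2) [(J + K)^T]linearD /= opprD addr0.
Qed.

(** The substitution l -> t l, m -> s m, followed by division by s t. Scaling the generators by the
    inverses of [s] and [t] is compensated on [J1] and [J2] by the diagonal [L]. *)
Lemma cubic_scale s t p q p2 q2 : s != 0 -> t != 0 ->
  cubic_equiv (p, q, p2, q2)
    (s * p, t ^+ 2 / s * q, s ^+ 2 / t * p2, t * q2).
Proof.
move=> s0 t0.
apply: pencil_equiv_trans (pencil_equiv_scale _ _ (invr_neq0 s0) (invr_neq0 t0)) _.
rewrite !skewmxZ.
pose L : 'M[C]_4 := block_mx s%:M 0 0 t%:M : 'M_(2 + 2).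
have Lu : L \in unitmx.
  by rewrite unitmxE /L (@det_ublock _ 2 2) !det_scalar unitfE mulf_neq0 ?expf_neq0.
have LD c x y : L *m (c *: deps x y) *m L^T = deps (s ^+ 2 * c * x) (t ^+ 2 * c * y).
  rewrite -scalemxAr -scalemxAl /L /deps (@tr_block_mx _ 2 2 2 2).
  rewrite !trmx0 !tr_scalar_mx !(@mulmx_block _ 2 2 2 2 2 2).
  rewrite !mulmx0 !mul0mx ?addr0 ?add0r (@scale_block_mx _ 2 2 2 2).
  rewrite !mul_scalar_mx !mul_mx_scalar !scaler0 !scalerA.
  by apply: eq_block22 => //; congr (_ *: _); ring.
apply: (@pencil_equiv_skewmx L 0 1%:M); rewrite ?unitmx1 //.
- rewrite LD trmx0 mulmx0 !mul0mx subr0 addr0; congr deps; by field.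
- rewrite trmx1 mulmx1 -scalemxAr /L /J1 (@mul_block_col _ 2 2 2 2 2).
  by rewrite !mulmx0 !mul0mx !mulmx1 ?addr0 ?add0r (@scale_col_mx _ 2 2 2)
    scaler0 scale_scalar_mx mulVf.
- rewrite LD trmx0 mulmx0 !mul0mx subr0 addr0; congr deps; by field.
- rewrite trmx1 mulmx1 -scalemxAr /L /J2 (@mul_block_col _ 2 2 2 2 2).
  by rewrite !mulmx0 !mul0mx !mulmx1 ?addr0 ?add0r (@scale_col_mx _ 2 2 2)
    scaler0 scale_scalar_mx mulVf.
Qed.

(** The substitution l -> l + t m, realised by adding [t] times the first generator to the
    second. *)
Lemma cubic_shear t p q p2 q2 :
  cubic_equiv (p, q, p2, q2)
    (p + 2%:R * t * q2 + 3%:R * t ^+ 2 * q, q,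
     p2 + t * p + t ^+ 2 * q2 + t ^+ 3 * q, q2 + 3%:R * t * q).
Proof.
apply: pencil_equiv_trans (pencil_equiv_shear t _ _) _.
rewrite !skewmxZ skewmxD.
(* [L] fixes [J1] and brings [J2 + t *: J1] back to [J2], but creates off-diagonal blocks. [S] is
   the shear of [canonicalize] for them: [- (t * q) *: eps] in the first form,
   [- (t * (q2 + t * q)) *: eps] in the second. *)
pose L : 'M[C]_4 := block_mx 1%:M (- t%:M) 0 1%:M : 'M_(2 + 2).
pose S : 'M[C]_(4, 2) := 
  col_mx (- (t * (q2 + t * q)) *: eps) (- (t * q) *: eps) : 'M_(2 + 2, 2).
have Lu : L \in unitmx.
  by rewrite unitmxE /L (@det_ublock _ 2 2) !det1 mulr1 unitr1.
have LD x y : L *m deps x y *m L^T =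
   block_mx ((x + t ^+ 2 * y) *: eps) (- (t * y) *: eps) (- (t * y) *: eps)
     (y *: eps) :> 'M_(2 + 2).
  rewrite /L /deps (@tr_block_mx _ 2 2 2 2).
  rewrite !trmx0 !linearN /= !tr_scalar_mx
    !(@mulmx_block _ 2 2 2 2 2 2).
  rewrite !mulmx0 !mul0mx !mulmx1 !mul1mx ?addr0 ?add0r.
  rewrite ?(mulNmx, mulmxN) !mul_scalar_mx !mul_mx_scalar !scalerA ?opprK.
  by apply: eq_block22; apply/matrixP => i j; rewrite !mxE; ring.
have LJ1 : L *m J1 = J1.
  by rewrite /L /J1 (@mul_block_col _ 2 2 2 2 2) !mulmx0 !mul0mx !mulmx1 ?addr0 ?add0r.
have LJ2 : L *m (J2 + t *: J1) = J2.
  rewrite mulmxDr -scalemxAr LJ1 /L /J2 /J1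
    (@mul_block_col _ 2 2 2 2 2) (@scale_col_mx _ 2 2 2) (@add_col_mx _ 2 2 2).
  by rewrite !mulmx0 ?mul0mx !mulmx1 ?addr0 ?add0r scaler0 addr0 scale_scalar_mx mulr1 addNr.
have dD : deps p2 q2 + t *: deps p q = deps (p2 + t * p) (q2 + t * q).
  by rewrite /deps (@scale_block_mx _ 2 2 2 2) (@add_block_mx _ 2 2 2 2)
    !scaler0 !addr0 !scalerA !scalerDl.
have tr_sw (X : 'M[C]_(4, 2)) (Y : 'M[C]_(4, 2)): X *m Y^T *m L^T = X *m (L *m Y)^T.
  by rewrite trmx_mul mulmxA.
apply: (@pencil_equiv_skewmx L S 1%:M); rewrite ?unitmx1 //.
- rewrite LD tr_sw LJ1 /J1 /S !(@tr_col_mx _ 2 2 2).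
  rewrite !(@mul_col_row _ 2 2 2 2 2) !trmx0 trmx1 !mul1mx !mulmx1 !mul0mx !mulmx0.
  rewrite (@opp_block_mx _ 2 2 2 2) !(@add_block_mx _ 2 2 2 2) /deps.
  by apply: eq_block22; apply/matrixP => i j; rewrite !mxE; ring.
- by rewrite trmx1 mulmx1.
- rewrite dD LD tr_sw LJ2 /J2 /S !(@tr_col_mx _ 2 2 2).
  rewrite !(@mul_col_row _ 2 2 2 2 2) !trmx0 trmx1 !mul1mx !mulmx1 !mul0mx !mulmx0.
  rewrite (@opp_block_mx _ 2 2 2 2) !(@add_block_mx _ 2 2 2 2) /deps.
  by apply: eq_block22; apply/matrixP => i j; rewrite !mxE; ring.
- by rewrite trmx1 mulmx1.
Qed.

End Canon.

(** * Reduction at a point of rank 4 *)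

Section Nondeg.

Variable C : numClosedFieldType.
Implicit Types (E : MAeq C) (P : 'M[C]_(4, 6)) (g N M : 'M[C]_6).
Notation eps := (epsmx C).

Definition jetmx (u v : 'I_4 -> C) : 'M[C]_(4, 2) :=
  \matrix_(i, s) if s == 0 then u i else v i.

(** The last two rows are t1 = du - u_i dx^i and t2 = dv - v_i dx^i, which span the annihilator of
    the graph plane with slopes [U]. *)
Definition graphmx (U : 'M[C]_(4, 2)) : 'M[C]_6 :=
  block_mx 1%:M 0 (- U^T) 1%:M : 'M_(4 + 2).

(** Order and signs follow [linpart], so that the columns are the images of t1 and t2 under the
    bivector. *)
Definition gradmx E (u v : 'I_4 -> C) : 'M[C]_(4, 2) :=
  \matrix_(i, s) if s == 0 then dFv E u i else - dFu E v i.

Lemma graphmx_unit U : graphmx U \in unitmx.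
Proof. by rewrite unitmxE /graphmx (@det_lblock _ 4 2) !det1 mulr1 unitr1. Qed.

Lemma graphmx_congr U E :
  graphmx U *m bivector E *m (graphmx U)^T =
  (block_mx (quadpart E) (linpart E - quadpart E *m U)
   (- (linpart E - quadpart E *m U)^T)
   (U^T *m quadpart E *m U - U^T *m linpart E + (U^T *m linpart E)^T
    + ma_m E *: eps) : 'M_(4 + 2)).
Proof.
rewrite /graphmx /bivector (@tr_block_mx _ 4 2 4 2) !(@mulmx_block _ 4 2 4 2 4 2).
rewrite !trmx0 !trmx1 !mul0mx !mulmx0 !mul1mx !mulmx1 ?addr0 ?add0r.
have -> : (- U^T)^T = - U by rewrite linearN /= trmxK.
have -> : (linpart E - quadpart E *m U)^T = (linpart E)^T + U^T *m quadpart E.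
  by rewrite linearB /= trmx_mul tr_quadpart mulmxN opprK.
rewrite trmx_mul trmxK mulmxN mulmxDl ?(mulNmx, mulmxN) opprD !opprK.
rewrite [- _ + linpart E]addrC [- (linpart E)^T - _]addrC.
by rewrite addrA [_ + (linpart E)^T *m U - _]addrAC.
Qed.

Lemma gradmxE E u v : linpart E - quadpart E *m jetmx u v = gradmx E u v.
Proof.
apply/matrixP => i s; rewrite !mxE.
case: ifP => e; rewrite ?[RHS]opprD [RHS]addrC; congr (_ + _); rewrite -?sumrN;
  apply: eq_bigr => j _; rewrite !mxE e; ring.
Qed.

(** The left side is the lower right block in [graphmx_congr]. Being skew of size 2, it is
    determined by its value on (t1, t2), so it vanishes exactly when the plane satisfies the
    equation. *)
Lemma skew_form_jetmx E u v :
  (jetmx u v)^T *m quadpart E *m jetmx u v - (jetmx u v)^T *m linpart E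
   + ((jetmx u v)^T *m linpart E)^T + ma_m E *: eps = aeval E u v *: eps.
Proof.
set U := jetmx u v; set X := LHS.
have Xs : X^T = - X.
  have AT : (U^T *m quadpart E *m U)^T = - (U^T *m quadpart E *m U).
    by rewrite !trmx_mul trmxK tr_quadpart mulNmx mulmxN mulmxA.
  rewrite /X; apply/matrixP => i j; move/matrixP: AT => /(_ i j).
  move: (_ *m U) (_ *m linpart E) => A B; rewrite !mxE => ->.
  by ring.
rewrite [LHS]skew2 //; congr (_ *: _).
rewrite /X /aeval !mxE /= subr0 mulr1; congr (_ + _).
have -> : \sum_j ((U^T *m quadpart E) 0 j * U j 1) =
   \sum_i \sum_j ma_a E i j * (u i * v j - u j * v i).
  under eq_bigr do rewrite !mxE mulr_suml.
  transitivity (\sum_i \sum_j (ma_a E i j * (u i * v j) - ma_a E j i * (u i * v j))).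
    rewrite exchange_big /=; apply: eq_bigr => i _; apply: eq_bigr => j _.
    rewrite !mxE /=; ring.
  under eq_bigr do rewrite sumrB.
  rewrite sumrB [X in _ - X]exchange_big /= -sumrB; apply: eq_bigr => i _.
  rewrite -sumrB; apply: eq_bigr => j _; ring.
congr (_ + _ + _); rewrite -?sumrN; apply: eq_bigr => i _; rewrite !mxE /=; ring.
Qed.

Lemma det_mx22 (A : 'M[C]_2) : \det A = A 0 0 * A 1 1 - A 0 1 * A 1 0.
Proof.
rewrite (expand_det_row _ 0) !big_ord_recl big_ord0 addr0 /cofactor !det_mx11 !mxE /=.
rewrite expr0 expr1 mul1r mulN1r mulrN.
by congr (_ * A _ _ - A _ _ * A _ _); apply: val_inj.
Qed.

Definition symbolmx (S : MAsys C) u v : 'M[C]_4 :=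
  row_mx (gradmx (sysF S) u v) (gradmx (sysG S) u v) : 'M_(4, 2 + 2).

(** The characteristic quadric is (p.F_u)(p.G_v) - (p.F_v)(p.G_u), so its polar matrix factors
    through the matrix of these four linear forms. Rank 4 makes that matrix invertible. *)
Lemma symbolmx_unit (S : MAsys C) u v : quadric_rank (chardet S u v) = 4%N ->
  symbolmx S u v \in unitmx.
Proof.
set R := symbolmx S u v.
rewrite /quadric_rank => r4; rewrite -row_full_unit -col_leq_rank.
set F := sysF S; set G := sysG S.
pose X : 'M[C]_4 := col_mx
   (\matrix_(s < 2, j < 4) if s == 0 then - (dFu G v j / 2%:R) else - (dFv G u j / 2%:R))
   (\matrix_(s < 2, j < 4) if s == 0 then dFu F v j / 2%:R else dFv F u j / 2%:R)
   : 'M_(2 + 2, 4).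
suff e : polar (chardet S u v) = R *m X by rewrite -[leqLHS]r4 e mxrankM_maxl.
have cd p : chardet S u v p =
   (\sum_i p i * dFu F v i) * (\sum_i p i * dFv G u i)
   - (\sum_i p i * dFv F u i) * (\sum_i p i * dFu G v i).
  rewrite /chardet det_mx22 !summxE.
  by congr (_ * _ - _ * _); apply: eq_bigr => i _; rewrite !mxE.
have b1 i (f : 'I_4 -> C) : \sum_k basisv C i k * f k = f i.
  rewrite (bigD1 i) //= big1 ?addr0 /basisv ?eqxx ?mul1r // => k /negPf ->.
  by rewrite mul0r.
have b2 i j (f : 'I_4 -> C) : \sum_k (basisv C i k + basisv C j k) * f k = f i + f j.
  by under eq_bigr do rewrite mulrDl; rewrite big_split !b1.
apply/matrixP => i j; rewrite [LHS]mxE !cd !b1 !b2.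
rewrite /R /symbolmx /X (@mul_row_col _ 4 2 2 4) !mxE !big_ord_recl !big_ord0 !mxE /=.
by field.
Qed.

Lemma onX_pencil_equiv (S : MAsys C) u v : onX S u v ->
  pencil_equiv (bivector (sysF S)) (bivector (sysG S))
    (skewmx (quadpart (sysF S)) (gradmx (sysF S) u v))
    (skewmx (quadpart (sysG S)) (gradmx (sysG S) u v)).
Proof.
move=> [eF eG].
have e E : aeval E u v = 0 ->
    graphmx (jetmx u v) *m bivector E *m (graphmx (jetmx u v))^T =
    skewmx (quadpart E) (gradmx E u v).
  by move=> e; rewrite graphmx_congr skew_form_jetmx gradmxE e scale0r.
have := pencil_equiv_congr (bivector (sysF S)) (bivector (sysG S)) (graphmx_unit (jetmx u v)).
by rewrite !e.
Qed.

Lemma good_point_canon (S : MAsys C) u v : good_point S u v ->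
  exists f, reaches_canon (bivector (sysF S)) (bivector (sysG S)) f.
Proof.
move=> [/onX_pencil_equiv/pencil_equiv_trans H1 /symbolmx_unit].
set F := sysF S in H1 *; set G := sysG S in H1 *.
set R := symbolmx _ _ _ => Ru.
pose L := invmx R.
(* The blocks [J1] and [J2] side by side form the identity, so the inverse of the symbol matrix
   normalises both gradients at once. *)
have LR : row_mx (L *m gradmx F u v) (L *m gradmx G u v) = row_mx (J1 C) (J2 C).
  rewrite -mul_mx_row [LHS](mulVmx Ru) (@scalar_mx_block _ 2 2) /J1 /J2.
  exact: (@block_mxEh _ 2 2 2 2).
have [LF LG] := eq_row_mx LR.
have sk E : (L *m quadpart E *m L^T)^T = - (L *m quadpart E *m L^T).
  by rewrite !trmx_mul trmxK tr_quadpart mulNmx mulmxN mulmxA.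
have [f Hf] := canonicalize (sk F) (sk G).
exists f; case: f Hf => [[[p q] p2] q2] Hf.
apply: H1; apply: pencil_equiv_trans Hf.
apply: (@pencil_equiv_skewmx _ L 0 1%:M); rewrite ?unitmx1 ?unitmx_inv //.
- by rewrite trmx0 mulmx0 !mul0mx subr0 addr0.
- by rewrite trmx1 mulmx1.
- by rewrite trmx0 mulmx0 !mul0mx subr0 addr0.
- by rewrite trmx1 mulmx1.
Qed.

End Nondeg.

(** * Classification *)

Section Main.

Variable C : numClosedFieldType.
Notation eps := (epsmx C).
Implicit Types f : C * C * C * C.

Lemma reaches_canon_trans (N M : 'M[C]_6) f f' :
  reaches_canon N M f -> cubic_equiv f f' -> reaches_canon N M f'.
Proof.
by move: f f' => [[[p q] p2] q2] [[[p' q'] p2'] q2'] /pencil_equiv_trans; apply.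
Qed.

Lemma cubic_equiv_trans f f' f'' :
  cubic_equiv f f' -> cubic_equiv f' f'' -> cubic_equiv f f''.
Proof. by move: f => [[[p q] p2] q2]; apply: reaches_canon_trans. Qed.

Lemma cubic_equiv_refl f : cubic_equiv f f.
Proof. by move: f => [[[p q] p2] q2]; apply: pencil_equiv_base. Qed.

Lemma cubic_root (a b c d : C) : a != 0 ->
  exists t, d + t * c + t ^+ 2 * b + t ^+ 3 * a = 0.
Proof.
move=> a0; have /closed_rootP[t] : size (Poly [:: d; c; b; a]) != 1%N.
  by rewrite (@PolyK _ 0).
by rewrite /root horner_Poly /= => /eqP e; exists t; rewrite -[RHS]e; ring.
Qed.

(** If (t : 1) is a root of the cubic, the shear by [t] kills the coefficient of m^3, and the swap
    turns it into that of l^3. *)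
Lemma cubic_equiv_q0 f : exists p p2 q2, cubic_equiv f (p, 0, p2, q2).
Proof.
move: f => [[[p q] p2] q2].
have [->|q0] := eqVneq q 0; first by exists p, p2, q2; apply: cubic_equiv_refl.
have [t et] := cubic_root q2 p p2 q0.
have := @cubic_shear C t p q p2 q2; rewrite et => H.
exists (q2 + 3%:R * t * q), q, (p + 2%:R * t * q2 + 3%:R * t ^+ 2 * q).
by apply: cubic_equiv_trans H _; apply: cubic_swap.
Qed.

Lemma cubic_classification f :
  [\/ cubic_equiv f (0, 0, 0, 0), cubic_equiv f (0, 0, 1, 0),
      cubic_equiv f (0, 0, 0, 1) | cubic_equiv f (0, 0, 1, 1)].
Proof.
have dbl (q2 : C) : q2 != 0 -> cubic_equiv (0, 0, 0, q2) (0, 0, 0, 1).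
  move=> q0; have := @cubic_scale C 1 q2^-1 0 0 0 q2 (oner_neq0 _) (invr_neq0 q0).
  by rewrite !mulr0 mulVf.
have [p [p2 [q2 /cubic_equiv_trans H]]] := cubic_equiv_q0 f.
have [q20|q2N] := eqVneq q2 0; last first.
  (* The cubic is m (q2 l^2 + p l m + p2 m^2); completing the square removes the middle term. What
     remains has a double root if [p2'] is 0 and three simple roots otherwise. *)
  have := @cubic_shear C (- (p / (2%:R * q2))) p 0 p2 q2.
  rewrite !mulr0 !addr0 => /cubic_equiv_trans => H1.
  have {}H f' (h : cubic_equiv _ f') := H f' (H1 f' h); move: H {H1}.
  have -> : p + 2%:R * - (p / (2%:R * q2)) * q2 = 0 by field.
  set p2' := p2 + _ + _ => H.
  have [e|p20] := eqVneq p2' 0.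
    by apply: Or43; apply: H; rewrite e; apply: dbl.
  apply: Or44; apply: H.
  (* Scaling with [t] equal to the inverse of [q2] makes the coefficient of l^2 m equal to 1, and
     that of m^3 becomes [s ^+ 2 * q2 * p2']. *)
  pose s := sqrtC (q2^-1 / p2').
  have s2 : s ^+ 2 = q2^-1 / p2' by rewrite sqrtCK.
  have s0 : s != 0 by rewrite sqrtC_eq0 mulf_neq0 ?invr_neq0.
  have := @cubic_scale C s q2^-1 0 0 p2' q2 s0 (invr_neq0 q2N).
  rewrite !mulr0 s2 mulVf // (_ : _ * p2' = 1) //; by field; apply/andP.
(* The cubic is now m^2 (p l + p2 m): zero or a triple root if [p] is 0, a double root otherwise. *)
subst q2; have [p0|pN] := eqVneq p 0.
  subst p; have [p20|p2N] := eqVneq p2 0; subst.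
    by apply: Or41; apply: H; apply: cubic_equiv_refl.
  apply: Or42; apply: H.
  have := @cubic_scale C 1 p2 0 0 p2 0 (oner_neq0 _) p2N.
  by rewrite !mulr0 expr1n mul1r mulVf.
apply: Or43; apply: H.
have := @cubic_shear C (- (p2 / p)) p 0 p2 0; rewrite !mulr0 !addr0.
have -> : p2 + - (p2 / p) * p = 0 by field.
move/cubic_equiv_trans; apply.
by apply: cubic_equiv_trans (@cubic_swap C p 0 0 0) (dbl p pN).
Qed.

(** * Canonical pencils of the four normal forms *)

Lemma eps_sqr : eps *m eps = - 1%:M.
Proof.
apply/matrixP => i j; rewrite !mxE !big_ord_recl big_ord0 !mxE /=.
case: i => -[|[|//]] ip; case: j => -[|[|//]] jp ; rewrite /bump /=; ring.
Qed.

Lemma det_eps : \det eps = 1.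
Proof. by rewrite det_mx22 !mxE -[nat_of_ord 1]/1%N -[nat_of_ord 0]/0%N; ring. Qed.

Lemma J1E (i : 'I_4) (s : 'I_2) : J1 C i s = ((i : nat) == s)%:R.
Proof.
rewrite /J1; case: (@split_ordP 2 2 i) => k ->.
  by rewrite (@col_mxEu _ 2 2 2) mxE.
rewrite (@col_mxEd _ 2 2 2) mxE; case: s => s /=; case: eqP => // e1 e2.
by move: e2; rewrite -e1.
Qed.

Lemma quadpart0 b c m : quadpart (MAEq (z2 C) b c m) = deps 0 0.
Proof.
apply/matrixP => i j; rewrite /deps !scale0r (@block_mx0 _ 2 2 2 2).
by rewrite !mxE subrr.
Qed.

Lemma quadpart01 b c m :
  quadpart (MAEq (fun i j => dlt C i 0 * dlt C j 1) b c m) = deps 1 0.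
Proof.
apply/matrixP => i j; rewrite /deps mxE /dlt /bump /=.
case: (@split_ordP 2 2 i) => -[[|[|//]] kp] ->;
  case: (@split_ordP 2 2 j) => -[[|[|//]] lp] ->;
  rewrite ?(@block_mxEul _ 2 2 2 2) ?(@block_mxEur _ 2 2 2 2)
    ?(@block_mxEdl _ 2 2 2 2) ?(@block_mxEdr _ 2 2 2 2) !mxE /=; by ring.
Qed.

Lemma quadpart23 b c m :
  quadpart (MAEq (fun i j => dlt C i 2 * dlt C j 3) b c m) = deps 0 1.
Proof.
apply/matrixP => i j; rewrite /deps mxE /dlt /bump /=.
case: (@split_ordP 2 2 i) => -[[|[|//]] kp] ->;
  case: (@split_ordP 2 2 j) => -[[|[|//]] lp] ->;
  rewrite ?(@block_mxEul _ 2 2 2 2) ?(@block_mxEur _ 2 2 2 2)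
    ?(@block_mxEdl _ 2 2 2 2) ?(@block_mxEdr _ 2 2 2 2) !mxE /=; by ring.
Qed.

Lemma gradmx_eqA u v : gradmx (eqA C) u v = - J1 C.
Proof.
apply/matrixP => i s; rewrite [RHS]mxE J1E mxE /dFu /dFv.
rewrite !big1 ?add0r; try by move=> *; rewrite /= subrr mul0r.
case: s => -[|[|//]] sp; case: i => -[|[|[|[|//]]]] ip; rewrite /= /dlt /bump /=; by ring.
Qed.

Lemma reaches_canon_diag x y :
  reaches_canon (skewmx (deps 0 0) (- J1 C))
    (skewmx (deps x y) (col_mx 0 (- eps) : 'M_(2 + 2, 2))) (0, 0, x, y).
Proof.
(* As [eps] has determinant 1 and square -1, this [L] fixes every [deps p q] while sending the two
   gradients to [J1] and [J2]. *)
pose L : 'M[C]_4 := block_mx (-1)%:M 0 0 eps : 'M_(2 + 2).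
have LD p q : L *m deps p q *m L^T = deps p q.
  rewrite /L /deps (@tr_block_mx _ 2 2 2 2) !(@mulmx_block _ 2 2 2 2 2 2).
  rewrite !trmx0 !tr_scalar_mx !mulmx0 !mul0mx ?addr0 ?add0r.
  rewrite mul_scalar_mx mul_mx_scalar -scalemxAr eps_sqr -scalemxAl mulNmx mul1mx tr_eps opprK.
  by rewrite !scaleN1r opprK !mul0mx.
apply: (@pencil_equiv_skewmx _ L 0 1%:M); rewrite ?unitmx1 //.
- by rewrite unitmxE /L (@det_ublock _ 2 2) det_eps det_scalar sqrrN expr1n mulr1 unitr1.
- by rewrite LD trmx0 mulmx0 !mul0mx subr0 addr0.
- rewrite trmx1 mulmx1 mulmxN /L /J1 (@mul_block_col _ 2 2 2 2 2) (@opp_col_mx _ 2 2 2).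
  by rewrite !mulmx0 mul_scalar_mx scaleN1r !mul0mx !addr0 oppr0 opprK.
- by rewrite LD trmx0 mulmx0 !mul0mx subr0 addr0.
- rewrite trmx1 mulmx1 /L /J2 (@mul_block_col _ 2 2 2 2 2).
  by rewrite !mulmx0 !mul0mx !add0r mulmxN eps_sqr opprK.
Qed.

Lemma reaches_canon_NF4 :
  reaches_canon (skewmx (deps 0 0) (- J1 C))
    (skewmx (deps 0 1) (col_mx (- eps) (- eps) : 'M_(2 + 2, 2))) (0, 0, 1, 1).
Proof.
pose L : 'M[C]_4 := block_mx (-1)%:M 1%:M 0 eps : 'M_(2 + 2).
(* [L] turns [deps 0 1] into [[eps, 1], [-1, eps]], whence the two coefficients 1. The upper half of
   [S] clears the off-diagonal identity and, being symmetric, leaves the first form zero. *)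
pose S : 'M[C]_(4, 2) := col_mx 1%:M 0 : 'M_(2 + 2, 2).
have LJ1 : L *m - J1 C = J1 C.
  rewrite mulmxN /L /J1 (@mul_block_col _ 2 2 2 2 2) (@opp_col_mx _ 2 2 2).
  by rewrite !mulmx0 mul_scalar_mx scaleN1r !mul0mx !addr0 oppr0 opprK.
have LJ2 : L *m (col_mx (- eps) (- eps) : 'M_(2 + 2, 2)) = J2 C.
  rewrite /L /J2 (@mul_block_col _ 2 2 2 2 2) mul_scalar_mx scaleN1r mul1mx mul0mx.
  by rewrite add0r mulmxN eps_sqr !opprK addrN.
have tr_sw (X : 'M[C]_(4, 2)) (Y : 'M[C]_(4, 2)): X *m Y^T *m L^T = X *m (L *m Y)^T.
  by rewrite trmx_mul mulmxA.
apply: (@pencil_equiv_skewmx _ L S 1%:M); rewrite ?unitmx1 //.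
- by rewrite unitmxE /L (@det_ublock _ 2 2) det_eps det_scalar sqrrN expr1n mulr1 unitr1.
- rewrite tr_sw LJ1 /S /J1 subrr addr0 /deps !scale0r (@block_mx0 _ 2 2 2 2).
  by rewrite mulmx0 mul0mx.
- by rewrite trmx1 mulmx1.
- rewrite tr_sw LJ2 /S /J2 !(@tr_col_mx _ 2 2 2) !(@mul_col_row _ 2 2 2 2 2).
  rewrite /L /deps (@tr_block_mx _ 2 2 2 2) !(@mulmx_block _ 2 2 2 2 2 2).
  rewrite !trmx0 !trmx1 !tr_scalar_mx !scale0r !scale1r
    ?(mulmx0, mul0mx, mulmx1, mul1mx, addr0, add0r).
  rewrite eps_sqr tr_eps ?(mulNmx, mulmxN, mul1mx, eps_sqr, opprK)
    (@opp_block_mx _ 2 2 2 2) !(@add_block_mx _ 2 2 2 2).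
  by rewrite ?(oppr0, sub0r, subr0, addr0, addrN, addNr).
- by rewrite trmx1 mulmx1.
Qed.

Lemma gradmx_std E u v : (forall i, dFv E u i = dlt C i 3) ->
  (forall i, dFu E v i = dlt C i 2) ->
  gradmx E u v = col_mx 0 (- eps) :> 'M_(2 + 2, 2).
Proof.
move=> ev eu; apply/matrixP => i s; rewrite mxE ev eu.
by case: (@split_ordP 2 2 i) => -[[|[|//]] kp] ->;
  rewrite ?(@col_mxEu _ 2 2 2) ?(@col_mxEd _ 2 2 2) !mxE /dlt /bump /=;
  case: s => -[|[|//]] sp /=; ring.
Qed.

Lemma NF1_canon :
  reaches_canon (bivector (sysF (NF1 C))) (bivector (sysG (NF1 C))) (0, 0, 0, 0).
Proof.
have X0 : onX (NF1 C) (fun=> 0) (fun=> 0).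
  by split; rewrite /aeval /= !big_ord_recl !big_ord0 /z2 /bump /=; ring.
apply: pencil_equiv_trans (onX_pencil_equiv X0) _; rewrite /= !quadpart0 gradmx_eqA gradmx_std.
- exact: reaches_canon_diag.
- by move=> i; rewrite /dFv /= big1 ?add0r // => j _; rewrite mulr0.
- by move=> i; rewrite /dFu /= big1 ?add0r // => j _; rewrite mulr0.
Qed.

Lemma NF2_canon :
  reaches_canon (bivector (sysF (NF2 C))) (bivector (sysG (NF2 C))) (0, 0, 1, 0).
Proof.
have X0 : onX (NF2 C) (fun=> 0) (fun=> 0).
  by split; rewrite /aeval /= !big_ord_recl !big_ord0 /z2 /bump /=; ring.
apply: pencil_equiv_trans (onX_pencil_equiv X0) _; rewrite /= quadpart0 quadpart01 gradmx_eqA gradmx_std.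
- exact: reaches_canon_diag.
- by move=> i; rewrite /dFv /= big1 ?add0r // => j _; rewrite mulr0.
- by move=> i; rewrite /dFu /= big1 ?add0r // => j _; rewrite mulr0.
Qed.

Lemma NF3_canon :
  reaches_canon (bivector (sysF (NF3 C))) (bivector (sysG (NF3 C))) (0, 0, 0, 1).
Proof.
(* The zero jet is not on X. Taking u_3 = v_4 = 1 satisfies the second equation and gives it the
   same gradient as u_3 + v_4. *)
have X0 : onX (NF3 C) (fun i => dlt C i 2) (fun i => dlt C i 3).
  by split; rewrite /aeval /= !big_ord_recl !big_ord0 /z2 /z1 /dlt /bump /=; ring.
apply: pencil_equiv_trans (onX_pencil_equiv X0) _; rewrite /= quadpart0 quadpart23 gradmx_eqA gradmx_std.
- exact: reaches_canon_diag.
- move=> i; rewrite /dFv /= !big_ord_recl big_ord0 /z1 /dlt /bump /=; by ring.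
- move=> i; rewrite /dFu /= !big_ord_recl big_ord0 /z1 /dlt /bump /=; by ring.
Qed.

Lemma NF4_canon :
  reaches_canon (bivector (sysF (NF4 C))) (bivector (sysG (NF4 C))) (0, 0, 1, 1).
Proof.
(* The zero jet lies on X, but both gradients there involve only the first two rows. Setting u_3 =
   v_4 = 1 brings in the others, and u_1 = v_2 = -1/2 keeps the point on X. *)
pose u i := dlt C i 2 - dlt C i 0 / 2%:R.
pose v i := dlt C i 3 - dlt C i 1 / 2%:R.
have X0 : onX (NF4 C) u v.
  by split; rewrite /aeval /= !big_ord_recl !big_ord0 /z2 /z1 /u /v /dlt /bump /=; field.
apply: pencil_equiv_trans (onX_pencil_equiv X0) _; rewrite /= quadpart0 quadpart23 gradmx_eqA.
rewrite (_ : gradmx _ u v = col_mx (- eps) (- eps) :> 'M_(2 + 2, 2)).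
  exact: reaches_canon_NF4.
apply/matrixP => i s; rewrite mxE /dFu /dFv !big_ord_recl !big_ord0 /u /v.
by case: (@split_ordP 2 2 i) => -[[|[|//]] kp] ->;
  rewrite ?(@col_mxEu _ 2 2 2) ?(@col_mxEd _ 2 2 2) !mxE /dlt /bump /=;
  case: s => -[|[|//]] sp /=; field.
Qed.

End Main.

Theorem theorem2 (C : numClosedFieldType) (S : MAsys C) :
  lin_indep S -> MA_nondegenerate S ->
  SL_equiv S (NF1 C) \/ SL_equiv S (NF2 C) \/
  SL_equiv S (NF3 C) \/ SL_equiv S (NF4 C).
Proof.
move=> _ [[u [v /good_point_canon[f Sf]]] _].
(* Both systems reach the same canonical pencil, so one reduction followed by the inverse of the
   other joins them. *)
have key S' f' : cubic_equiv f f' ->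
    reaches_canon (bivector (sysF S')) (bivector (sysG S')) f' -> SL_equiv S S'.
  move=> /(reaches_canon_trans Sf); case: f' => [[[p q] p2] q2] H H'.
  by apply: pencil_equiv_SL; apply: pencil_equiv_trans H (pencil_equiv_sym H').
case: (cubic_classification f) => /key H.
- by left; apply: H; apply: NF1_canon.
- by right; left; apply: H; apply: NF2_canon.
- by right; right; left; apply: H; apply: NF3_canon.
- by right; right; right; apply: H; apply: NF4_canon.
Qed.
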